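(* Let $k \geq e^{15}$ and let $G$ be a triangle-free graph with $\iota(G) > 3k + 1$. Then $G$ has a cycle of length at least $3k^2\log k$.
   Context: All graphs are finite and simple. For nonempty $X \subseteq V(G)$, $\alpha(X)$ is the independence number of the subgraph induced by $X$, and $\iota(G) := \sup_{\emptyset\neq X \subseteq V(G)} |X|/\alpha(X)$. $\log$ is the natural logarithm. *)

(* Defs.v *)
From HB Require Import structures.
From mathcomp Require Import all_boot all_order all_algebra.
From mathcomp Require Import all_classical all_reals all_analysis.

Set Implicit Arguments.
Unset Strict Implicit.
Unset Printing Implicit Defensive.

Import Order.TTheory GRing.Theory Num.Theory.

Local Open Scope ring_scope.

(* A finite simple graph on [V : finType] is an adjacency relation
   [e : rel V] that is symmetric and irreflexive; the definitions below do
   not use these two hypotheses. *)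

Definition induced (V : finType) (e : rel V) (X : {set V}) :
  rel {x : V | x \in X} := fun x y => e (val x) (val y).

Definition independent (V : finType) (e : rel V) (S : {set V}) : bool :=
  [forall x in S, forall y in S, ~~ e x y].

Definition indep_number (V : finType) (e : rel V) : nat :=
  \max_(S : {set V} | independent e S) #|S|.

(* Real supremum of a finite set of ratios; on the graph with no vertex the
   set is empty and [sup] returns 0. *)
Definition iota_ratio (R : realType) (V : finType) (e : rel V) : R :=
  sup (fun r : R => exists2 X : {set V}, X != finset.set0 &
         r = #|X|%:R / (indep_number (@induced V e X))%:R).

Definition triangle_free (V : finType) (e : rel V) : Prop :=
  forall x y z : V, ~~ [&& e x y, e y z & e z x].

(* [ucycleb e] alone also accepts the empty sequence and, for a symmetric
   [e], a single edge traversed back and forth. *)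
Definition is_cycle (V : finType) (e : rel V) (c : seq V) : bool :=
  (3 <= size c)%N && ucycleb e c.

(* Main.v *)
Require Import Defs.
From mathcomp Require Import all_boot all_order all_algebra.
From mathcomp Require Import boolp.
From mathcomp Require Import zify ring lra.

(* Take [X] minimal with |X| > (3k + 1) alpha(X).  Let [S] be the set of ends
   reached from a longest path of G[X] by Posa rotations and [T] the union of
   [S] and its neighbours in [X].  Then |T| <= 3 |S| and some cycle contains
   [T].  Since alpha(X) >= alpha(S) + alpha(X \ T), minimality of [X] gives
   |T| > (3k + 1) alpha(S), hence |S| > k alpha(S).  All degrees in G[S] are at
   most alpha(S) because neighbourhoods are independent, so Shearer's lower
   bound for the independence number of a triangle-free graph yields
   alpha(S) >= k log k and finally |T| > 3 k^2 log k. *)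

Set Implicit Arguments.
Unset Strict Implicit.
Unset Printing Implicit Defensive.

Import Order.TTheory GRing.Theory Num.Theory.

(** * Rotations of a longest path *)

Definition closed_nbhd (V : finType) (e : rel V) (X S : {set V}) : {set V} :=
  S :|: [set y in X | [exists z in S, e z y]].

Lemma in_closed_nbhd (V : finType) (e : rel V) (X S : {set V}) y :
  y \in closed_nbhd e X S =
    (y \in S) || (y \in X) && [exists z in S, e z y].
Proof. by rewrite in_setU [y \in [set _ | _]]inE. Qed.

Section Posa.

Variables (V : finType) (e : rel V).
Hypotheses (e_sym : symmetric e) (e_irr : irreflexive e).
Variables (X : {set V}) (p : seq V).

(* The moving end of the path is the head of the list, so that a rotation
   reverses a prefix. *)
Inductive rotated : seq V -> Prop :=
| rotated_refl : rotated p
| rotated_step z A y B : rotated (z :: A ++ y :: B) -> e z y ->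
    rotated (rev (z :: A) ++ y :: B).

Definition rot_ends : {set V} :=
  [set z | `[< exists q, rotated (z :: q) >]].

Local Notation rot_nbhd := (closed_nbhd e X rot_ends).

Lemma rot_endsP z : reflect (exists q, rotated (z :: q)) (z \in rot_ends).
Proof. by rewrite inE; apply: asboolP. Qed.

(** Reversing the prefix in front of the pivot [y] brings the predecessor of [y] to the head. *)
Lemma rotated_last z A y B : rotated (z :: A ++ y :: B) -> e z y ->
  last z A \in rot_ends.
Proof.
move=> rq ezy; apply/rot_endsP.
have := rotated_step rq ezy; case/lastP: A rq => [|A w] rq /=.
  by rewrite /= => h; exists (y :: B).
by rewrite last_rcons -rcons_cons rev_rcons /= => h; eexists; exact: h.
Qed.

Lemma rotated_perm q : rotated q -> perm_eq q p.
Proof.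
elim=> [//|z A y B _ IH ezy].
by apply: perm_trans IH; rewrite -cat_cons perm_cat2r perm_rev.
Qed.

Lemma sorted_rotate (z y : V) A B : e z y -> sorted e (z :: A ++ y :: B) ->
  sorted e (rev (z :: A) ++ y :: B).
Proof.
move=> ezy; rewrite /= cat_path /= => /and3P [pA _ pB].
have : sorted e (rev (z :: A)).
  by rewrite rev_sorted; apply: sub_path pA => u v; rewrite e_sym.
have : last z (rev (z :: A)) = z by rewrite rev_cons last_rcons.
case: (rev (z :: A)) => [|x q] /= lq; first by move=> _; exact: pB.
by rewrite cat_path /= => -> /=; rewrite lq ezy.
Qed.

Lemma rotated_sorted q : sorted e p -> rotated q -> sorted e q.
Proof. by move=> sp; elim=> [//|z A y B _ IH ezy]; apply: sorted_rotate. Qed.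

Lemma rotated_lastE x q : rotated q -> last x q = last x p.
Proof.
elim=> [//|z A y B _ <- ezy].
by rewrite last_cat /= last_cat.
Qed.

Definition consec (q : seq V) u v := exists A B, q = A ++ u :: v :: B.

Lemma consec_rev q u v : consec q u v -> consec (rev q) v u.
Proof.
move=> [A [B ->]]; exists (rev B), (rev A).
by rewrite rev_cat !rev_cons -!cats1 -!catA.
Qed.

Lemma consec_catl A B u v : consec A u v -> consec (A ++ B) u v.
Proof. by move=> [C [D ->]]; exists C, (D ++ B); rewrite -catA. Qed.

Lemma consec_catr A B u v : consec B u v -> consec (A ++ B) u v.
Proof. by move=> [C [D ->]]; exists (A ++ C), D; rewrite -catA. Qed.

Lemma consec_split z A y B u v : consec (z :: A ++ y :: B) u v ->
  [\/ consec (z :: A) u v, u = last z A | consec (y :: B) u v].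
Proof.
case=> C [D]; elim: C z A => [|c C IH] z [|a A] /=.
- by case=> -> _ _; constructor 2.
- by case=> -> -> _; constructor 1; exists [::], A.
- by case=> _ E; constructor 3; exists C, D.
- case=> _ /IH [[C' [D' E]]|->|h]; last by constructor 3.
    by constructor 1; exists (z :: C'), D'; rewrite E.
  by constructor 2.
Qed.

(* A rotation deletes a single edge of the path, and one end of that edge
   becomes the new end of the path. *)
Lemma rotated_consec q u v : rotated q -> consec p u v ->
  [\/ consec q u v \/ consec q v u, u \in rot_ends | v \in rot_ends].
Proof.
move=> rq puv; elim: rq => [|z A y B rq IH ezy]; first by constructor 1; left.
have wS := rotated_last rq ezy.
case: IH => [[|] /consec_split [h|h|h]|h|h];
  try by [constructor 2|constructor 3].
- by constructor 1; right; apply/consec_catl/consec_rev.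
- by constructor 2; rewrite h.
- by constructor 1; left; apply/consec_catr.
- by constructor 1; left; apply/consec_catl/consec_rev.
- by constructor 3; rewrite h.
- by constructor 1; right; apply/consec_catr.
Qed.

Lemma uniq_cat_inj (A B C D : seq V) y : uniq (A ++ y :: B) ->
  A ++ y :: B = C ++ y :: D -> A = C /\ B = D.
Proof.
elim: A C => [|a A IH] [|c C] //=.
- by move=> _ [->].
- by move=> /andP[nB _] [yc E]; move: nB; rewrite E mem_cat inE eqxx orbT.
- by move=> /andP[nA _] [E _]; move: nA; rewrite E mem_cat inE eqxx orbT.
- by move=> /andP[_ u] [-> /(IH _ u) [-> ->]].
Qed.

Lemma next_consec (q : seq V) u v : uniq q -> consec q u v -> next q u = v.
Proof.
move=> uq [A [B E]]; rewrite E in uq *.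
rewrite -(next_rot (size A) uq) rot_size_cat /= eqxx //.
Qed.

Lemma prev_consec (q : seq V) u v : uniq q -> consec q u v -> prev q v = u.
Proof. by move=> uq /(next_consec uq) <-; apply: prev_next. Qed.


Hypotheses (p_uniq : uniq p) (p_sorted : sorted e p) (p_sub : {subset p <= X}).
Hypothesis p_max : forall q, uniq q -> sorted e q -> {subset q <= X} ->
  (size q <= size p)%N.

Lemma rotated_uniq q : rotated q -> uniq q.
Proof. by move=> /rotated_perm /perm_uniq ->. Qed.

Lemma rotated_mem q : rotated q -> q =i p.
Proof. by move=> /rotated_perm /perm_mem. Qed.

(** A neighbour of [z] in [X] off the path could be prepended to it, against the maximality of
    [p]. *)
Lemma rotated_nbhd z q y : rotated (z :: q) -> y \in X -> e z y ->
  exists A B, q = A ++ y :: B.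
Proof.
move=> rq yX ezy; have [/path.splitPr[A B]|ynq] := boolP (y \in q).
  by exists A, B.
have yz : y != z by apply: contraTneq ezy => ->; rewrite e_irr.
have /= /andP[zq uq] := rotated_uniq rq.
suff : (size (y :: z :: q) <= size p)%N.
  by rewrite -(perm_size (rotated_perm rq)) /= ltnn.
apply: p_max => /=.
- by rewrite inE negb_or yz ynq zq uq.
- by rewrite e_sym ezy; exact: (rotated_sorted p_sorted rq).
- move=> u; rewrite in_cons => /predU1P[->//|uq'].
  by apply: p_sub; rewrite -(rotated_mem rq).
Qed.

Lemma rot_ends_sub : {subset rot_ends <= p}.
Proof.
by move=> z /rot_endsP[q rq]; rewrite -(rotated_mem rq) mem_head.
Qed.

Lemma closed_nbhd_sub : {subset rot_nbhd <= p}.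
Proof.
move=> y; rewrite in_closed_nbhd => /orP[/rot_ends_sub//|].
move=> /andP[yX /exists_inP[z /rot_endsP[q rq] ezy]].
have [A [B E]] := rotated_nbhd rq yX ezy.
by rewrite -(rotated_mem rq) E in_cons mem_cat mem_head !orbT.
Qed.

(** Let [y], not itself an end, be adjacent to the head of a rotated path. Its predecessor [w] there
    is an end. If the edges of [p] at [y] all survive on that path, then [w] is a neighbour of [y]
    along [p]; if one was deleted, its other vertex is an end by [rotated_consec]. *)
Lemma closed_nbhd_next_prev y : y \in rot_nbhd ->
  [|| y \in rot_ends, y \in next p @: rot_ends | y \in prev p @: rot_ends].
Proof.
move=> yT; have yp := closed_nbhd_sub yT; move: yT.
rewrite in_closed_nbhd; have [//|/= ynS] := boolP (y \in rot_ends).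
move=> /andP[yX /exists_inP[z /rot_endsP[q rq] ezy]].
have [A [B E]] := rotated_nbhd rq yX ezy; rewrite {q}E in rq.
have wS := rotated_last rq ezy; set w := last z A in wS.
have uq := rotated_uniq rq.
have cwy : consec (z :: A ++ y :: B) w y.
  exists (belast z A), B; rewrite -cat_cons (lastI z A) -/w -cats1 -catA //.
have nextS u : u \in rot_ends -> consec p u y -> y \in next p @: rot_ends.
  by move=> uS c; apply/imsetP; exists u => //; rewrite (next_consec p_uniq c).
have prevS u : u \in rot_ends -> consec p y u -> y \in prev p @: rot_ends.
  by move=> uS c; apply/imsetP; exists u => //; rewrite (prev_consec p_uniq c).
have {yp} [C [D Ep]] : exists C D, p = C ++ y :: D.
  by case/path.splitPr: yp => C D; exists C, D.
(* The first vertex of [p] is an end without any rotation, so [y] has a predecessor [u] on [p]. *)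
case/lastP: C Ep => [|C u] Ep.
  case/negP: ynS; apply/rot_endsP; exists D.
  by rewrite -[y :: D]Ep; apply: rotated_refl.
have cuy : consec p u y by exists C, D; rewrite Ep -cats1 -catA.
case: (rotated_consec rq cuy) => [[c|c]|/nextS->//|/(negP ynS)//].
  have uw : u = w by rewrite -(prev_consec uq c) (prev_consec uq cwy).
  by rewrite (nextS u) // uw.
(* In the remaining case [u] follows [y] on the rotated path. Rotations fix the last vertex, so [y]
   is not last on [p] and has a successor [v] there. *)
case: D Ep => [|v D] Ep.
  have := rotated_lastE y rq; rewrite Ep !last_cat /= last_cat /= => lB.
  have [A' [B' E]] := c.
  have [_ EB] := uniq_cat_inj (A := z :: A) uq E.
  have := uq; rewrite -cat_cons cat_uniq /= => /and4P[_ _ /negP[]].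
  by rewrite EB /= in lB *; rewrite -{1}lB mem_last.
have cyv : consec p y v by exists (rcons C u), D.
(* The place after [y] is taken by [u], so a surviving edge to [v] makes [v] the predecessor [w]. *)
case: (rotated_consec rq cyv) => [[c'|c']|/(negP ynS)//|vS].
- have uv : u = v by rewrite -(next_consec uq c) (next_consec uq c').
  have := p_uniq; rewrite Ep uv -cats1 -catA cat_uniq /=.
  by rewrite !inE eqxx !orbT !andbF.
- have wv : w = v by rewrite -(prev_consec uq c') (prev_consec uq cwy).
  by rewrite (prevS v) ?orbT // -wv.
- by rewrite (prevS v) ?orbT.
Qed.

Lemma split_last (a : pred V) q : has a q ->
  exists C t D, [/\ q = C ++ t :: D, a t & all (predC a) D].
Proof.
elim: q => [//|x q IH] /=; have [/IH|] := boolP (has a q).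
  by case=> C [t [D [-> at' nD]]] _; exists (x :: C), t, D.
by rewrite -all_predC => nq; rewrite orbF => ax; exists [::], x, q.
Qed.

(* Every pivot of a rotation is in [rot_nbhd], so the part of the path
   beyond the last vertex of [rot_nbhd] is never moved. *)
Lemma rotated_suffix C t D q : p = C ++ t :: D ->
  {in D, forall y, y \notin rot_nbhd} -> rotated q ->
  exists C', q = C' ++ t :: D.
Proof.
move=> Ep nD rq; elim: rq => [|z A y B rq [C' E] ezy]; first by exists C.
have yT : y \in rot_nbhd.
  rewrite in_closed_nbhd; apply/orP; right; apply/andP; split.
    apply: p_sub; rewrite -(rotated_mem rq) -cat_cons mem_cat mem_head orbT //.
  by apply/exists_inP; exists z => //; apply/rot_endsP; eexists; exact: rq.
have uq := rotated_uniq rq.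
have : y \in C' ++ t :: D by rewrite -E -cat_cons mem_cat mem_head orbT.
rewrite mem_cat in_cons => /or3P[yC|/eqP yt|/nD]; last by rewrite yT.
  case/path.splitPr: yC E => C1 C2; rewrite -cat_cons -catA => E.
  rewrite -cat_cons in uq; have [_ ->] := uniq_cat_inj uq E.
  by exists (rev (z :: A) ++ y :: C2); rewrite -catA.
move: E uq; rewrite -yt -cat_cons => E uq; have [_ ->] := uniq_cat_inj uq E.
by exists (rev (z :: A)).
Qed.

(** Let [t] be the last vertex of [rot_nbhd] on [p]. Every rotated path keeps its part from [t] on,
    hence has all of [rot_nbhd] up to [t]; a rotated path whose head is adjacent to [t] is cut after
    [t] and closed. *)
Lemma closed_nbhd_cycle : (2 < #|rot_nbhd|)%N ->
  exists2 c, is_cycle e c & {subset rot_nbhd <= c}.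
Proof.
move=> T2.
have [C [t [D [Ep tT nD]]]] : exists C t D, [/\ p = C ++ t :: D,
    t \in rot_nbhd & {in D, forall y, y \notin rot_nbhd}].
  have : has (mem rot_nbhd) p.
    have /card_gt0P[t tT] : (0 < #|rot_nbhd|)%N by apply: leq_trans T2.
    by apply/hasP; exists t => //; apply: closed_nbhd_sub.
  case/split_last => C [t [D [-> tT /allP nD]]]; exists C, t, D; split=> //.
have inC q C' : rotated q -> q = C' ++ t :: D ->
    {subset rot_nbhd <= rcons C' t}.
  move=> rq E y yT; have := closed_nbhd_sub yT.
  rewrite -(rotated_mem rq) E -cat_rcons mem_cat => /orP[//|/nD].
  by rewrite yT.
(* With nothing before [t], all of [rot_nbhd] would lie in the singleton of [t]. *)
have Cnil C' q z : rotated (z :: q) -> z :: q = C' ++ t :: D -> C' != [::].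
  move=> rq E; apply: contraTneq T2 => C'0; rewrite -leqNgt.
  apply: (@leq_trans #|[set t]|); last by rewrite cards1.
  apply/subset_leq_card/subsetP.
  by move=> y /(inC _ _ rq E); rewrite C'0 !inE.
(* If [t] were an end, it would head a rotated path and occur on it again after a nonempty prefix.
   So [t] is adjacent to an end. *)
have [z [q [rq ezt]]] : exists z q, rotated (z :: q) /\ e z t.
  move: tT; rewrite in_closed_nbhd => /orP[/rot_endsP[q rq]|].
    have [[|c C'] E] := rotated_suffix Ep nD rq.
      by have := Cnil _ _ _ rq E.
    have := rotated_uniq rq; case: E => _ ->.
    by rewrite /= mem_cat mem_head orbT.
  by case/andP=> _ /exists_inP[z /rot_endsP[q rq] ezt]; exists z, q.
have [C' E] := rotated_suffix Ep nD rq.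
have C'0 := Cnil _ _ _ rq E.
have cT := inC _ _ rq E.
have := rotated_uniq rq; have := rotated_sorted p_sorted rq.
case: C' C'0 E cT {Cnil} => // z' C' _ [<- Eq] cT.
rewrite Eq -cat_rcons -cat_cons cat_uniq /= cat_path => /andP[pC _] /andP[uC _].
exists (z :: rcons C' t) => //; rewrite /is_cycle /ucycleb.
apply/and3P; split=> //.
- apply: leq_trans T2 _; rewrite -(@card_uniqP _ (z :: rcons C' t) uC).
  apply/subset_leq_card/subsetP.
  exact: cT.
- by rewrite /= rcons_path pC last_rcons e_sym.
Qed.

Lemma card_closed_nbhd : (#|rot_nbhd| <= 3 * #|rot_ends|)%N.
Proof.
have sub : rot_nbhd \subset
    rot_ends :|: (next p @: rot_ends :|: prev p @: rot_ends).
  by apply/subsetP => y /closed_nbhd_next_prev; rewrite !in_setU.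
apply: leq_trans (subset_leq_card sub) _.
rewrite (leq_trans (leq_card_setU _ _).1) // mulSn mul2n -addnn leq_add2l.
rewrite (leq_trans (leq_card_setU _ _).1) // leq_add ?leq_imset_card //.
Qed.

End Posa.

Lemma posa_cycle (V : finType) (e : rel V) (X : {set V}) :
  symmetric e -> irreflexive e -> X != set0 ->
  exists S : {set V}, let T := closed_nbhd e X S in
    [/\ S \subset X, S != set0, (#|T| <= 3 * #|S|)%N &
        (2 < #|T|)%N -> exists2 c, is_cycle e c & {subset T <= c}].
Proof.
move=> e_sym e_irr /set0Pn[x xX].
pose P n := `[< exists q : seq V,
  [/\ uniq q, sorted e q, {subset q <= X} & size q = n] >].
have P1 : P 1.
  by apply/asboolP; exists [:: x]; split=> // y; rewrite inE => /eqP->.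
have Pb n : P n -> (n <= #|V|)%N.
  by move=> /asboolP[q [/card_uniqP<- _ _ <-]]; apply: max_card.
have [n /asboolP[p [up sp pX <-]] p_max] := ex_maxnP (ex_intro P 1 P1) Pb.
have {}p_max q : uniq q -> sorted e q -> {subset q <= X} ->
    (size q <= size p)%N.
  by move=> uq sq qX; apply: p_max; apply/asboolP; exists q.
exists (rot_ends e p); split.
- by apply/subsetP => y /rot_ends_sub /pX.
- have : (0 < size p)%N.
    by apply: (p_max [:: x]) => // y; rewrite inE => /eqP->.
  case: p {up sp pX p_max} => [//|z p' _].
  apply/set0Pn; exists z; apply/rot_endsP; exists p'; exact: rotated_refl.
- exact: card_closed_nbhd.
- exact: closed_nbhd_cycle.
Qed.

(** * Independence number and edge counts *)

(** Independence number of an induced subgraph, kept inside [V] so that different subsets can be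
    compared without subtypes. *)
Definition alpha (V : finType) (e : rel V) (X : {set V}) : nat :=
  \max_(S : {set V} | independent e S && (S \subset X)) #|S|.

(** Ordered pairs are counted, so [edges e X X] is the degree sum of the subgraph on [X]. *)
Definition edges (V : finType) (e : rel V) (A B : {set V}) : nat :=
  (\sum_(u in A) \sum_(w in B) e u w)%N.

Section Graph.

Variables (V : finType) (e : rel V).
Hypotheses (e_sym : symmetric e) (e_irr : irreflexive e).
Hypothesis e_tf : triangle_free e.

Lemma independentP (S : {set V}) :
  reflect {in S &, forall x y, ~~ e x y} (independent e S).
Proof.
apply: (iffP forall_inP) => h x.
  by move=> y xS yS; have /forall_inP/(_ y yS) := h x xS.
by move=> xS; apply/forall_inP => y yS; apply: h.
Qed.

Lemma leq_alpha (S X : {set V}) :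
  independent e S -> S \subset X -> (#|S| <= alpha e X)%N.
Proof. by move=> iS SX; apply: leq_bigmax_cond; rewrite iS. Qed.

Lemma alpha_witness (X : {set V}) :
  exists S : {set V}, [/\ independent e S, S \subset X & #|S| = alpha e X].
Proof.
have P0 : independent e set0 && (set0 \subset X).
  by rewrite sub0set andbT; apply/independentP => x; rewrite inE.
have := @eq_bigmax_cond _ [pred S | independent e S && (S \subset X)]
  (fun S => #|S|).
case; first by apply/card_gt0P; exists set0.
by move=> S /andP[iS SX] E; exists S; rewrite iS SX /alpha -E.
Qed.

Lemma alpha_gt0 (X : {set V}) : X != set0 -> (0 < alpha e X)%N.
Proof.
move=> /set0Pn[x xX]; rewrite -(cards1 x) leq_alpha ?sub1set //.
by apply/independentP => y z; rewrite !inE => /eqP-> /eqP->; rewrite e_irr.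
Qed.

(** No edge joins [S] to the part of [X] outside its closed neighbourhood, so independent sets of
    the two can be united. *)
Lemma alphaD_closed_nbhd (S X : {set V}) : S \subset X ->
  (alpha e S + alpha e (X :\: closed_nbhd e X S) <= alpha e X)%N.
Proof.
move=> SX; have [I [/independentP iI IS <-]] := alpha_witness S.
have [J [/independentP iJ JX <-]] := alpha_witness (X :\: closed_nbhd e X S).
have IJ x y : x \in I -> y \in J -> ~~ e x y.
  move=> /(subsetP IS) xS /(subsetP JX); rewrite inE in_closed_nbhd.
  rewrite negb_or => /andP[/andP[_ n] yX]; apply: contra n => exy.
  by rewrite yX; apply/exists_inP; exists x.
have dIJ : [disjoint I & J].
  apply/pred0P => x /=; apply/negP => /andP[/(subsetP IS) xS /(subsetP JX)].
  by rewrite inE in_closed_nbhd xS.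
rewrite -(eqP (_ : #|I :|: J| == #|I| + #|J|)%N) ?(leq_card_setU I J).2 //.
apply: leq_alpha; last first.
  by rewrite subUset (subset_trans IS) // (subset_trans JX) ?subsetDl.
apply/independentP => x y; rewrite !in_setU => /orP[xI|xJ] /orP[yI|yJ].
- exact: iI.
- exact: IJ.
- by rewrite e_sym IJ.
- exact: iJ.
Qed.

(** In a triangle-free graph the neighbours of [v] form an independent set. *)
Lemma degree_alpha (X : {set V}) v :
  (\sum_(w in X) e v w <= alpha e X)%N.
Proof.
rewrite -big_mkcondr sum1_card -cardsE leq_alpha //.
  apply/independentP => x y; rewrite !inE => /andP[_ vx] /andP[_ vy].
  by apply/negP => xy; have /negP[] := e_tf v x y; rewrite vx xy e_sym vy.
by apply/subsetP => x; rewrite !inE => /andP[].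
Qed.

Lemma edges_sym A B : edges e A B = edges e B A.
Proof.
rewrite /edges exchange_big; apply: eq_bigr => x _; apply: eq_bigr => y _.
by rewrite e_sym.
Qed.

Lemma edges_splitl (A B C : {set V}) :
  edges e A C = (edges e (A :&: B) C + edges e (A :\: B) C)%N.
Proof. exact: big_setID. Qed.

Lemma edges_subset (A B C : {set V}) :
  A \subset B -> (edges e A C <= edges e B C)%N.
Proof.
by move=> AB; rewrite (edges_splitl B A) (setIidPr AB) leq_addr.
Qed.

(** The neighbours of [v] span no edge, so each edge at one of them leaves the neighbourhood and is
    counted twice in [edges e X X]; the sum on the left is the degree sum of these neighbours. *)
Lemma edges_nbhd (X Y : {set V}) v : Y = X :\: closed_nbhd e X [set v] ->
  (edges e Y Y + 2 * \sum_(u in X) e v u * edges e [set u] X <= edges e X X)%N.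
Proof.
move=> YE.
pose N := [set u | e v u].
have YN : Y \subset X :\: N.
  apply/subsetP => y; rewrite YE !inE => /andP[h yX]; rewrite yX andbT.
  apply: contra h => vy; rewrite yX /=; apply/orP; right; apply/exists_inP.
  by exists v; rewrite ?inE.
have NN : edges e (X :&: N) (X :&: N) = 0.
  apply: big1 => x; rewrite !inE => /andP[_ vx]; apply: big1 => y.
  rewrite !inE => /andP[_ vy]; case xy: (e x y) => //.
  by have /negP[] := e_tf v x y; rewrite vx xy e_sym vy.
have -> : (\sum_(u in X) e v u * edges e [set u] X = edges e (X :&: N) X)%N.
  rewrite /edges [RHS](eq_bigl (fun u => (u \in X) && e v u)); last first.
    by move=> u; rewrite !inE.
  rewrite big_mkcondr; apply: eq_bigr => u _; rewrite big_set1.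
  by case: (e v u); rewrite ?mul1n ?mul0n.
have := edges_splitl X N X.
rewrite (edges_sym (X :\: N)) (edges_splitl X N (X :\: N)).
have := edges_splitl X N (X :&: N); rewrite NN.
have := edges_subset Y YN; have := edges_subset (X :\: N) YN.
rewrite (edges_sym Y (X :\: N)) (edges_sym X (X :&: N)).
rewrite (edges_sym (X :\: N) (X :&: N)).
lia.
Qed.

End Graph.

(** * Shearer's bound *)

Local Open Scope ring_scope.

Section Shearer.

Variables (R : realFieldType) (s : nat -> R) (N : nat).
Hypotheses (s_ge0 : forall i, 0 <= s i) (s_le : forall i, s i <= s i.+1).

(* Shearer's function of the average degree [d] is the integral over [s >= 0]
   of [(1 + s) ^- 2 / (1 + d s)].  Here it is replaced by a finite sum with
   nodes [s i.+1] and weights the integrals of [(1 + s) ^- 2] over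
   [[s i, s i.+1]]; it is multiplied by the number [n] of vertices, and
   [m = n d] is the degree sum. *)
Definition weight i : R := (1 + s i)^-1 - (1 + s i.+1)^-1.

Definition shearer (n m : R) : R :=
  \sum_(i < N) weight i * (n ^+ 2 / (n + m * s i.+1)).

Lemma weight_ge0 i : 0 <= weight i.
Proof.
have := s_ge0 i; have := s_le i => h1 h2.
by rewrite subr_ge0 lef_pV2 ?posrE ?lerD2l //; lra.
Qed.

(* Discrete counterpart of Shearer's differential equation: the right-hand
   side telescopes. *)
Lemma weight_le (i : nat) (d : R) : 0 <= d ->
  weight i * ((1 + d + 2 * d * s i.+1) / (1 + d * s i.+1) ^+ 2) <=
  ((1 + s i) * (1 + d * s i))^-1 - ((1 + s i.+1) * (1 + d * s i.+1))^-1.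
Proof.
rewrite /weight => d0; have := s_ge0 i; have := s_le i.
set a := s i; set b := s i.+1 => ab a0.
have da : 0 <= d * a by apply: mulr_ge0.
have db : 0 <= d * b by apply: mulr_ge0 => //; lra.
rewrite -subr_ge0.
have -> : ((1 + a) * (1 + d * a))^-1 - ((1 + b) * (1 + d * b))^-1 -
   ((1 + a)^-1 - (1 + b)^-1) * ((1 + d + 2 * d * b) / (1 + d * b) ^+ 2) =
   d ^+ 2 * (b - a) ^+ 2 / ((1 + a) * (1 + d * a) * (1 + d * b) ^+ 2).
  by field; rewrite ?gt_eqF //; lra.
apply: divr_ge0; first by rewrite mulr_ge0 ?sqr_ge0.
by rewrite !mulr_ge0 ?sqr_ge0 //; lra.
Qed.

(** Deleting a closed neighbourhood gains one independent vertex; this bounds by that gain the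
    average loss in [shearer]. *)
Lemma weight_sum_le1 (d : R) : 0 <= d ->
  \sum_(i < N) weight i * ((1 + d + 2 * d * s i.+1) / (1 + d * s i.+1) ^+ 2)
    <= 1.
Proof.
move=> d0; pose g i := ((1 + s i) * (1 + d * s i))^-1.
apply: (@le_trans _ _ (\sum_(0 <= i < N) (g i - g i.+1))).
  by rewrite big_mkord; apply: ler_sum => i _; apply: weight_le.
rewrite (@telescope_sumr_eq _ _ _ (fun i => - g i)) //; last first.
  by move=> i _; rewrite opprK addrC.
have g_le1 : g 0 <= 1.
  rewrite invf_le1 ?(lt_le_trans ltr01) //; have := s_ge0 0%N => s0;
  have := mulr_ge0 d0 s0; nra.
have gN : 0 <= g N by rewrite invr_ge0 mulr_ge0 // addr_ge0 // mulr_ge0.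
lra.
Qed.

(* Tangent line of the convex function [a ^+ 2 / b]; the second hypothesis
   admits the junk case [a = b = 0], which the empty vertex set produces. *)
Lemma sqr_div_tangent (a b l : R) : 0 <= b -> (b = 0 -> a = 0) ->
  2 * l * a - l ^+ 2 * b <= a ^+ 2 / b.
Proof.
rewrite le_eqVlt => /predU1P[<- /(_ erefl)->|b0 _].
  by rewrite invr0 !mulr0 subr0.
rewrite ler_pdivlMr // -subr_ge0.
have -> : a ^+ 2 - (2 * l * a - l ^+ 2 * b) * b = (a - l * b) ^+ 2 by ring.
exact: sqr_ge0.
Qed.

Variables (V : finType) (e : rel V).
Hypotheses (e_sym : symmetric e) (e_irr : irreflexive e).
Hypothesis e_tf : triangle_free e.

Lemma card_closed_nbhd1 (X : {set V}) v : v \in X ->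
  (#|X :\: closed_nbhd e X [set v]| + 1 + \sum_(w in X) e v w)%N = #|X|.
Proof.
move=> vX; have sub : closed_nbhd e X [set v] \subset X.
  apply/subsetP => y; rewrite in_closed_nbhd inE => /orP[/eqP->//|].
  by case/andP.
rewrite -(cardsID (closed_nbhd e X [set v]) X) (setIidPr sub) -addnA addnC.
congr (_ + _)%N; rewrite -big_mkcondr sum1_card -cardsE.
have -> : closed_nbhd e X [set v] = v |: [set w in X | e v w].
  apply/setP => y; rewrite in_closed_nbhd !inE; congr (_ || (_ && _)).
  apply/exists_inP/idP => [[z]|]; first by rewrite inE => /eqP->.
  by exists v; rewrite ?inE.
by rewrite cardsU1 inE e_irr andbF.
Qed.

(* Averaging, over [v] in [X], the bound on [X] minus the closed neighbourhood
   of [v]. *)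
Lemma alpha_shearer (X : {set V}) :
  shearer #|X|%:R (edges e X X)%:R <= (alpha e X)%:R.
Proof.
have [k] := ubnP #|X|; elim: k => [//|k IH] in X *; rewrite ltnS => Xk.
set n : R := #|X|%:R; set m : R := (edges e X X)%:R.
set a : R := (alpha e X)%:R.
have [X0|X0] := eqVneq #|X| 0%N.
  rewrite /shearer /n X0 big1 ?ler0n // => i _.
  by rewrite expr2 !mul0r mulr0.
have n0 : 0 < n by rewrite ltr0n lt0n.
have m0 : 0 <= m by rewrite ler0n.
pose Y v := X :\: closed_nbhd e X [set v].
pose dg v : R := \sum_(w in X) (e v w)%:R.
(* The tangent of [a ^+ 2 / b] is taken at the values belonging to [X]. Being linear, it can be
   summed over [v], which leaves only the totals [P] and [Q]. *)
pose l i := n / (n + m * s i.+1).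
have ms0 i : 0 <= m * s i.+1 by rewrite mulr_ge0.
pose P := \sum_(v in X) #|Y v|%:R : R.
pose Q := \sum_(v in X) (edges e (Y v) (Y v))%:R : R.
pose F (p q : R) i := 2 * l i * p - l i ^+ 2 * (p + q * s i.+1).
have avg : n + \sum_(i < N) weight i * F P Q i <= n * a.
  have -> : n * a = \sum_(v in X) a by rewrite sumr_const -mulr_natl.
  have -> : n = \sum_(v in X) 1 by rewrite sumr_const.
  have -> : \sum_(i < N) weight i * F P Q i = \sum_(v in X) \sum_(i < N)
      weight i * F #|Y v|%:R (edges e (Y v) (Y v))%:R i.
    rewrite exchange_big; apply: eq_bigr => i _.
    by rewrite -mulr_sumr /F sumrB -!mulr_sumr big_split /= -mulr_suml.
  rewrite -big_split; apply: ler_sum => v vX /=.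
  apply: (@le_trans _ _ (1 + shearer #|Y v|%:R (edges e (Y v) (Y v))%:R)).
    rewrite lerD2l; apply: ler_sum => i _; apply: (ler_wpM2l (weight_ge0 i)).
    have h0 : 0 <= (edges e (Y v) (Y v))%:R * s i.+1 by rewrite mulr_ge0.
    apply: sqr_div_tangent; first by rewrite addr_ge0.
    move=> E; apply/eqP; rewrite eq_le ler0n andbT; lra.
  apply: (@le_trans _ _ (1 + (alpha e (Y v))%:R)).
    rewrite lerD2l IH //; apply: leq_trans Xk.
    by rewrite -(card_closed_nbhd1 vX) -addnA addnCA ltnS leq_addr.
  rewrite -[1]/(1%:R) -natrD ler_nat.
  have vX1 : [set v] \subset X by rewrite sub1set.
  apply: leq_trans (alphaD_closed_nbhd e_sym vX1).
  by rewrite leq_add2r alpha_gt0 //; apply/set0Pn; exists v; rewrite inE.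
have sum_dg : \sum_(v in X) dg v = m.
  by rewrite /m /edges natr_sum; apply: eq_bigr => v _; rewrite natr_sum.
have PE : P = n ^+ 2 - n - m.
  have YE v : v \in X -> #|Y v|%:R = n - 1 - dg v.
    move=> vX; rewrite /n -(card_closed_nbhd1 vX) !natrD natr_sum -/(dg v).
    by ring.
  rewrite /P (eq_bigr _ YE) !sumrB sum_dg !sumr_const -mulr_natl expr2.
  by rewrite -/n.
(* Summing [edges_nbhd] over [v] produces the sum of the squared degrees, which is at least
   [m ^+ 2 / n] by convexity (tangent at the mean degree [m / n]). *)
have QE : Q <= n * m - 2 * (m ^+ 2 / n).
  have dgE u : dg u = (edges e [set u] X)%:R.
    by rewrite /edges big_set1 natr_sum.
  have Qv v : v \in X -> (edges e (Y v) (Y v))%:R <=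
      m - 2 * \sum_(u in X) (e v u)%:R * dg u.
    move=> vX; rewrite lerBrDr.
    have := edges_nbhd e_sym e_tf (erefl (Y v)).
    rewrite -(ler_nat R) natrD natrM natr_sum.
    by under eq_bigr do rewrite natrM -dgE.
  apply: (le_trans (ler_sum _ Qv)).
  rewrite sumrB sumr_const -[m *+ _]mulr_natl -/n -mulr_sumr exchange_big /=.
  rewrite lerD2l lerN2 ler_wpM2l //.
  apply: (@le_trans _ _
    (\sum_(u in X) (2 * (m / n) * dg u - (m / n) ^+ 2 * 1))).
    rewrite sumrB -!mulr_sumr sum_dg sumr_const -/n le_eqVlt; apply/orP; left.
    by apply/eqP; field; rewrite gt_eqF.
  apply: ler_sum => u uX.
  have -> : \sum_(v in X) (e v u)%:R * dg u = dg u * dg u.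
    by rewrite -mulr_suml; congr (_ * _); apply: eq_bigr => v _; rewrite e_sym.
  have := sqr_ge0 (dg u - m / n); nra.
pose G i : R :=
  (1 + m / n + 2 * (m / n) * s i.+1) / (1 + m / n * s i.+1) ^+ 2.
(* [F] decreases in its second argument, and at the upper bound for [Q] the two sides agree. *)
have mainI i : n * (n ^+ 2 / (n + m * s i.+1)) - n * G i <= F P Q i.
  have A0 : 0 < n + m * s i.+1 by have := ms0 i; lra.
  apply: (@le_trans _ _ (F P (n * m - 2 * (m ^+ 2 / n)) i)); last first.
    by rewrite lerD2l lerN2 ler_wpM2l ?sqr_ge0 // lerD2l ler_wpM2r.
  rewrite le_eqVlt; apply/orP; left; apply/eqP; rewrite /F PE /l /G.
  by field; rewrite ?gt_eqF.
have := weight_sum_le1 (d := m / n) (divr_ge0 m0 (ltW n0)).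
rewrite -(ler_pM2l n0) mulr1 => w1.
rewrite -(ler_pM2l n0); apply: le_trans avg; rewrite -lerBlDl.
apply: (@le_trans _ _ (n * shearer n m - n * \sum_(i < N) weight i * G i)).
  by rewrite lerD2l lerN2.
rewrite /shearer !mulr_sumr -sumrB; apply: ler_sum => i _.
rewrite [n * (weight i * _)]mulrCA [n * (weight i * G i)]mulrCA -mulrBr.
by rewrite ler_wpM2l ?weight_ge0.
Qed.

End Shearer.

From mathcomp Require Import all_classical all_reals all_analysis.

Import Order.TTheory GRing.Theory Num.Theory.

(** * Numerical estimates and the bound [k * ln k] *)

Lemma ln_le_harmonic (R : realType) (N : nat) :
  ln (N.+2%:R / 2) <= \sum_(i < N) (i.+2%:R)^-1 :> R.
Proof.
elim: N => [|N IH]; first by rewrite big_ord0 divff ?ln1 // pnatr_eq0.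
rewrite big_ord_recr /=; apply: le_trans (lerD IH (lexx _)).
have N2 : 0 < N.+2%:R :> R by rewrite ltr0n.
have -> : N.+3%:R / 2 = N.+2%:R / 2 * (1 + N.+2%:R^-1) :> R.
  by rewrite -(natr1 N.+2); field; rewrite gt_eqF.
have Ni : 0 < N.+2%:R^-1 :> R by rewrite invr_gt0.
rewrite lnM ?posrE ?divr_gt0 ?addr_gt0 // lerD2l.
by apply: le_ln1Dx; apply: lt_trans Ni; rewrite ltrN10.
Qed.

(** From [1 + x <= expR x] at [x = - 1/4], the fourth power gives [expR 1 <= (4/3) ^+ 4]. The bound
    [15 / 4] matches [ln k >= 15]. *)
Lemma expR1_le (R : realType) : expR 1 <= 15 / 4 :> R.
Proof.
have e4 : 3 / 4 <= expR (- 4^-1) :> R.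
  by apply: le_trans (expR_ge1Dx _); lra.
have -> : expR 1 = (expR (- 4^-1) ^+ 4)^-1 :> R.
  by rewrite -expRM_natl -expRN; congr expR; field.
have e0 : 0 < expR (- 4^-1) :> R := expR_gt0 _.
have -> : 15 / 4 = (4 / 15)^-1 :> R by field.
rewrite lef_pV2 ?posrE ?exprn_gt0 //.
apply: (@le_trans _ _ ((3 / 4) ^+ 4)); first by lra.
by rewrite lerXn2r // nnegrE; lra.
Qed.

Lemma inv_sub_inv_ge (R : realType) (x y : R) : 0 <= x -> x <= y ->
  (y - x) * (1 - 2 * y) <= (1 + x)^-1 - (1 + y)^-1.
Proof.
move=> x0 xy; rewrite -subr_ge0.
have -> : (1 + x)^-1 - (1 + y)^-1 - (y - x) * (1 - 2 * y) =
    (y - x) * (1 - (1 - 2 * y) * (1 + x) * (1 + y)) / ((1 + x) * (1 + y)).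
  by field; rewrite !gt_eqF //; lra.
rewrite divr_ge0 ?mulr_ge0 //; try lra.
have [|] := lerP (1 - 2 * y) 0 => h.
  have := mulr_ge0 x0 (le_trans x0 xy); nra.
have : (1 - 2 * y) * (1 + x) * (1 + y) <= (1 - 2 * y) * (1 + y) * (1 + y).
  by rewrite ler_wpM2r ?ler_wpM2l; lra.
have y0 := le_trans x0 xy.
have := mulr_ge0 y0 (mulr_ge0 y0 y0); have := mulr_ge0 y0 y0; nra.
Qed.

(** With nodes [i / D], the [i]th weight is about [1 / D] and its factor at least [n / i.+2], so a
    harmonic sum appears. The error per term is at most [2 / D] inside the bracket, in total at most
    [1] since [N * 2 <= D]. *)
Lemma shearer_ge (R : realType) (N : nat) (D n m : R) :
  0 < D -> N%:R * 2 <= D -> 0 < n -> 0 <= m <= n * D ->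
  n * (ln (N.+2%:R / 2) - 1) / D <= shearer (fun i => i%:R / D) N n m.
Proof.
move=> D0 ND n0 /andP[m0 mD].
have Di : 0 < D^-1 by rewrite invr_gt0.
apply: (@le_trans _ _ (\sum_(i < N) n / D * (i.+2%:R^-1 - 2 / D))).
  rewrite -mulr_sumr sumrB sumr_const card_ord -[_ *+ N]mulr_natl.
  rewrite [n * _ / D]mulrAC ler_wpM2l ?divr_ge0 ?(ltW n0) ?(ltW D0) //.
  rewrite lerB ?ln_le_harmonic //.
  by rewrite mulrA ler_pdivrMr ?mul1r.
apply: ler_sum => i _; rewrite /weight.
have i0 : 0 <= i%:R / D by rewrite divr_ge0 // ltW.
have iS : i.+1%:R / D - i%:R / D = D^-1.
  by rewrite -(natr1 i); field; rewrite gt_eqF.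
have yD : D * (i.+1%:R / D) = i.+1%:R by field; rewrite gt_eqF.
have xy : i%:R / D <= i.+1%:R / D by rewrite -subr_ge0 iS ltW.
have := inv_sub_inv_ge i0 xy; rewrite iS.
set y := i.+1%:R / D in xy yD *; set w := (X in _ <= X) => hw.
have y0 : 0 < y by rewrite divr_gt0.
have i2 : i.+2%:R = 1 + D * y by rewrite yD -(natr1 i.+1) addrC.
have Dy : 0 < D * y by rewrite mulr_gt0.
have w0 : 0 <= w.
  by rewrite /w subr_ge0 lef_pV2 ?posrE; lra.
apply: (@le_trans _ _ (w * (n / (1 + D * y)))); last first.
  rewrite ler_wpM2l // ler_pdivrMr; last by lra.
  have my := mulr_ge0 m0 (ltW y0).
  rewrite mulrAC ler_pdivlMr; last by lra.
  have : m * y <= n * D * y by rewrite ler_wpM2r // ltW.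
  rewrite expr2 -!mulrA ler_pM2l // => h; lra.
rewrite i2.
apply: (@le_trans _ _ (D^-1 * (1 - 2 * y) * (n / (1 + D * y)))); last first.
  by rewrite ler_wpM2r // divr_ge0 //; lra.
have -> : n / D * ((1 + D * y)^-1 - 2 / D) =
    n / D / (1 + D * y) * (1 - 2 * (D^-1 + y)).
  by field; rewrite !gt_eqF //; lra.
have -> : D^-1 * (1 - 2 * y) * (n / (1 + D * y)) =
    n / D / (1 + D * y) * (1 - 2 * y).
  by field; rewrite !gt_eqF //; lra.
rewrite ler_wpM2l; first by [].
  by rewrite !divr_ge0 //; lra.
lra.
Qed.

(** If [alpha e S < D] with [D = k * ln k], all degrees in [S] are below [D], and Shearer's bound
    gives [alpha e S >= n * ln k / D = n / k], a contradiction. *)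
Lemma alpha_ge_mul_ln (R : realType) (k : R) (V : finType) (e : rel V)
    (S : {set V}) :
  symmetric e -> irreflexive e -> triangle_free e -> expR 15 <= k ->
  k * (alpha e S)%:R < #|S|%:R -> k * ln k <= (alpha e S)%:R.
Proof.
move=> e_sym e_irr e_tf k_ge kS; rewrite leNgt; apply/negP => aD.
have k0 : 0 < k := lt_le_trans (expR_gt0 _) k_ge.
have L15 : 15 <= ln k by rewrite -[15]expRK ler_ln // posrE ?expR_gt0.
have L0 : 0 < ln k by lra.
set D := k * ln k in aD *; have D0 : 0 < D by rewrite mulr_gt0.
set a : R := (alpha e S)%:R in kS aD *; set n : R := #|S|%:R in kS *.
have n0 : 0 < n by apply: le_lt_trans kS; rewrite mulr_ge0 ?(ltW k0).
(* The largest [N] that [shearer_ge] admits. *)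
pose N := Num.truncn (D / 2).
have /andP[ND DN] : N%:R <= D / 2 < N.+1%:R.
  by apply: truncn_itv; rewrite divr_ge0 ?ltW.
have m_le : (edges e S S)%:R <= n * D.
  apply: (@le_trans _ _ (n * a)); last by rewrite ler_wpM2l ?(ltW n0) ?(ltW aD).
  rewrite -natrM ler_nat -sum_nat_const; apply: leq_sum => v _.
  exact: degree_alpha.
have ND2 : N%:R * 2 <= D by rewrite -ler_pdivlMr.
have m0 : 0 <= ((edges e S S)%:R : R) <= n * D by rewrite ler0n m_le.
have := shearer_ge D0 ND2 n0 m0; apply/negP; rewrite -ltNge.
have s0 i : 0 <= i%:R / D by rewrite divr_ge0 // ltW.
have sS i : i%:R / D <= i.+1%:R / D by rewrite ler_pM2r ?invr_gt0 // ler_nat.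
have := alpha_shearer (s := fun i => i%:R / D) N s0 sS e_sym e_irr e_tf S.
move=> /le_lt_trans; apply.
apply: (@lt_le_trans _ _ (n / k)); first by rewrite ltr_pdivlMr // mulrC.
have -> : n / k = n * ln k / D by rewrite /D; field; rewrite !gt_eqF.
(* It remains that [ln (N.+2 / 2) - 1 >= ln k], where [N.+2 / 2 >= D / 4 =
   k * ln k / 4] and [ln k >= 15 >= 4 * expR 1]. *)
rewrite ler_pM2r ?invr_gt0 // ler_pM2l // lerBrDr.
have -> : ln k + 1 = ln (k * expR 1).
  by rewrite lnM ?posrE ?expR_gt0 // expRK.
rewrite ler_ln ?posrE ?mulr_gt0 ?expR_gt0 ?invr_gt0 //.
apply: (@le_trans _ _ (D / 4)).
  rewrite -mulrA ler_pM2l //; apply: le_trans (expR1_le R) _; lra.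
by rewrite -(natr1 N.+1); lra.
Qed.

(** * From [iota_ratio] to the long cycle *)

Lemma card_indep_number (V : finType) (e : rel V) (X : {set V}) :
  (alpha e X <= indep_number (@Defs.induced V e X))%N.
Proof.
have [S [/independentP iS SX <-]] := alpha_witness e X.
pose S' := [set x : {x | x \in X} | val x \in S].
have -> : #|S| = #|S'|.
  rewrite -(card_imset _ val_inj); apply: eq_card => x.
  apply/idP/imsetP => [xS|[y]]; last by rewrite inE => yS ->.
  by exists (Sub x (fintype.subsetP SX _ xS)); rewrite ?inE !SubK.
apply: (leq_bigmax_cond (P := fun S => independent _ S)).
by apply/independentP => x y; rewrite !inE; apply: iS.
Qed.

Lemma iota_ratio_witness (R : realType) (V : finType) (e : rel V) (c : R) :
  0 <= c -> c < iota_ratio R e ->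
  exists X : {set V}, c * (alpha e X)%:R < #|X|%:R.
Proof.
move=> c0 ic; have [r [X X0 ->] cr] : exists2 r : R,
    (exists2 X : {set V}, X != finset.set0 &
         r = #|X|%:R / (indep_number (@Defs.induced V e X))%:R) & c < r.
  (* An empty set of ratios has [sup] equal to [0], which does not exceed [c]. *)
  apply: (sup_gt _ ic); apply: contrapT => /nonemptyPn E.
  by move: ic; rewrite /iota_ratio E sup0 ltNge c0.
exists X; move: cr.
(* Division by zero yields the ratio [0], again not above [c]. *)
case: (posnP (indep_number (@Defs.induced V e X))) => [->|i0].
  by rewrite invr0 mulr0 ltNge c0.
rewrite ltr_pdivlMr ?ltr0n //; apply: le_lt_trans.
by rewrite ler_wpM2l // ler_nat card_indep_number.
Qed.

Theorem theorem6 (R : realType) (k : R) (V : finType) (e : rel V)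
    (e_sym : symmetric e) (e_irr : irreflexive e)
    (k_ge : expR 15 <= k)
    (e_tf : triangle_free e)
    (e_iota : 3 * k + 1 < iota_ratio R e) :
  exists c : seq V,
    is_cycle e c /\ 3 * k ^+ 2 * ln k <= (size c)%:R.
Proof.
have k0 : 0 < k := lt_le_trans (expR_gt0 _) k_ge.
have c0 : 0 <= 3 * k + 1 by lra.
have [X0 X0big] := iota_ratio_witness c0 e_iota.
have [X Xbig Xmin] := arg_minnP (fun X : {set V} => #|X|)
  (P := fun X => (3 * k + 1) * (alpha e X)%:R < #|X|%:R) X0big.
have X_neq0 : X != finset.set0.
  apply: contraTneq Xbig => ->; rewrite finset.cards0 -leNgt mulr_ge0 ?ler0n //.
have [S [SX S0 T3 cyc]] := posa_cycle e_sym e_irr X_neq0.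
move: T3 cyc; set T := closed_nbhd e X S => T3 cyc.
have ST : S \subset T.
  by apply/fintype.subsetP => x; rewrite in_closed_nbhd => ->.
have TX : T \subset X.
  apply/fintype.subsetP => x; rewrite in_closed_nbhd.
  case/orP=> [/(fintype.subsetP SX)//|].
  by case/andP.
have Tbig : (3 * k + 1) * (alpha e S)%:R < #|T|%:R.
  have cTX : (#|T| + #|X :\: T| = #|X|)%N.
    by rewrite -(finset.cardsID T X) (finset.setIidPr TX).
  have T0 : (0 < #|T|)%N.
    by rewrite card_gt0; apply: contraNneq S0 => E; rewrite -finset.subset0 -E.
  (* As [T] is nonempty, [X :\: T] is smaller than [X], so minimality applies to it. *)
  have XT : #|X :\: T|%:R <= (3 * k + 1) * (alpha e (X :\: T))%:R.
    by rewrite leNgt; apply/negP => /Xmin; rewrite -cTX; lia.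
  have aX := alphaD_closed_nbhd e_sym SX; rewrite -(ler_nat R) natrD in aX.
  have := ler_wpM2l c0 aX; rewrite mulrDr => aX'.
  move: Xbig; rewrite -cTX natrD => Xbig; lra.
have Sbig : k * (alpha e S)%:R < #|S|%:R.
  move: T3; rewrite -(ler_nat R) natrM => T3.
  have : 0 <= (alpha e S)%:R :> R by []; lra.
have aS := alpha_ge_mul_ln e_sym e_irr e_tf k_ge Sbig.
have size_T : 3 * k ^+ 2 * ln k <= #|T|%:R.
  apply: le_trans (ltW Tbig); apply: (@le_trans _ _ (3 * k * (k * ln k))).
    by rewrite le_eqVlt; apply/orP; left; apply/eqP; ring.
  apply: (@le_trans _ _ (3 * k * (alpha e S)%:R)).
    by rewrite ler_wpM2l //; lra.
  by rewrite ler_wpM2r //; lra.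
(* This rules out the degenerate case of [posa_cycle]; crude bounds on [k] and [ln k] suffice. *)
have T2 : (2 < #|T|)%N.
  rewrite -(ltr_nat R); apply: lt_le_trans size_T.
  have k16 : 16 <= k.
    by apply: le_trans k_ge; apply: le_trans (expR_ge1Dx _); lra.
  have L15 : 15 <= ln k by rewrite -[15]expRK ler_ln // posrE ?expR_gt0.
  nra.
have [c cyc_c Tc] := cyc T2; exists c; split=> //.
apply: le_trans size_T _; rewrite ler_nat.
by apply: leq_trans (card_size c); apply/subset_leq_card/fintype.subsetP.
Qed.
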